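(* The following two statements are equivalent. (A) For any integer $N>2$, there exists a prime $p>N$ such that, for some positive integer $a$ (and only one such positive integer $a$ exists for this $p$), the polynomial $f(x)=x^{2p}+ax^p-1$ is monogenic with $\mathrm{Gal}(f)\simeq C_p\rtimes C_{p-1}$. (B) There exist infinitely many primes of the form $z^2+4$, where $z$ is a positive integer.
   Context: A monic polynomial $f(x)\in\mathbb{Z}[x]$ of degree $n$ is called monogenic if $f(x)$ is irreducible over $\mathbb{Q}$ and $\{1,\theta,\theta^2,\ldots,\theta^{n-1}\}$ is a $\mathbb{Z}$-basis of the ring of integers of $\mathbb{Q}(\theta)$, where $f(\theta)=0$. $\mathrm{Gal}(f)$ denotes the Galois group over $\mathbb{Q}$ of the splitting field of $f(x)$. $C_N$ denotes the cyclic group of order $N$, and $C_p\rtimes C_{p-1}$ denotes the semidirect product in which $C_{p-1}$ acts faithfully on $C_p$, i.e. via an isomorphism $C_{p-1}\simeq\mathrm{Aut}(C_p)$. *)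

(* Defs.v *)
From HB Require Import structures.
From mathcomp Require Import all_boot all_order all_fingroup all_algebra.
From mathcomp Require Import all_solvable all_field.

Set Implicit Arguments.
Unset Strict Implicit.
Unset Printing Implicit Defensive.

Import GRing.Theory.
Local Open Scope ring_scope.

Definition Zbasis (V : zmodType) (M : V -> Prop) (n : nat) (b : 'I_n -> V) :=
  (forall x, M x <-> exists c : 'I_n -> int, x = \sum_(i < n) b i *~ c i) /\
  (forall c : 'I_n -> int,
     \sum_(i < n) b i *~ c i = 0 -> forall i, c i = 0).

Definition ring_of_integers (L : fieldExtType rat) (E : {subfield L}) (x : L) :=
  x \in E /\ integralOver (intr : int -> L) x.

(* The last clause is never vacuous: an irreducible f has a root in some finite
   extension of rat. *)
Definition monogenic (f : {poly int}) :=
  [/\ f \is monic,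
      irreducible_poly (map_poly (intr : int -> rat) f)
    & forall (L : fieldExtType rat) (theta : L),
        root (map_poly (intr : int -> L) f) theta ->
        Zbasis (ring_of_integers <<1; theta>>%AS)
               (fun i : 'I_(size f).-1 => theta ^+ i)].

Definition Gal_isog (f : {poly int}) (gT : finGroupType) (G : {group gT}) :=
  exists2 L : splittingFieldType rat,
    splittingFieldFor 1 (map_poly (intr : int -> L) f) {:L}
    & ('Gal({:L} / 1) \isog G)%g.

(* Here Zp n is the additive group of integers mod n, i.e. C_n; the external
   semidirect product sdprod_by to is, for p prime, independent of the choice
   of the faithful action to, up to isomorphism. *)
Definition Gal_isog_Cp_Cp1 (f : {poly int}) (p : nat) :=
  exists2 to : groupAction (Zp p.-1) (Zp p),
    [faithful Zp p.-1, on Zp p | to]%g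
    & Gal_isog f [set: sdprod_by to]%G.

(* Main.v *)
From HB Require Import structures.
From mathcomp Require Import classical_sets cardinality.
From mathcomp Require Import all_boot all_order all_fingroup all_algebra.
From mathcomp Require Import all_solvable all_field.
From mathcomp Require Import ring zify.
Require Import Defs.

(** Let theta be a root of f = X^(2p) + a X^p - 1. Then y = theta^p is a root of
    Y^2 + aY - 1, the roots of f are the p-th roots of y and of -1/y, and
    D = a^2 + 4 is the discriminant of the quadratic. The equivalence rests on
    one fact [trinomial_spec]: for an odd prime p and a > 0, the trinomial is
    monogenic with Galois group C_p : C_(p-1) if and only if p = a^2 + 4. Both
    statements then say that there are arbitrarily large primes z^2 + 4, and
    a is unique because p determines a^2.

    If the Galois group is C_p : C_(p-1), it is generated by a group of odd
    order together with one further element, so that the splitting field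
    contains at most one quadratic field [two_quadratics]. It contains the
    square root 2y + a of D and, with the p-th roots of unity, a square root
    of p* = (-1)^((p-1)/2) p [sqrt_pstarK]. Hence D p* is a square, which means
    D = p s^2 [trinomial_disc]. When s > 1, either (2y + a)/s or, for s = 2,
    (1 + (2y + a)/2)/2 is an algebraic integer whose coordinate on theta^p is
    not an integer, so monogenicity forces s = 1 [monogenic_trinomial_disc].

    Conversely let p = a^2 + 4. Modulo p the trinomial is (X - c)^(2p) with
    2c = -a, and p^2 does not divide f(c): it is irreducible by Eisenstein's
    argument and Z[theta] is maximal at p. Modulo any other prime it is
    separable, so that Z[theta] is maximal there too [monogenic_criterion].
    For the Galois group, p = 1 mod 4 and y lies in Q(sqrt p), inside Q(zeta_p),
    so the splitting field is the Kummer extension Q(zeta_p)(theta), of degree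
    p (p - 1) over Q [dim_splitting_field]. Its Galois group over Q(zeta_p) is
    normal of order p and is its own centraliser [cent_gal_kummer]; a group of
    order p (p - 1) with such a subgroup is C_p : C_(p-1) [holomorph_Cp]. *)

Set Implicit Arguments.
Unset Strict Implicit.
Unset Printing Implicit Defensive.

Import GRing.Theory Num.Theory.

(** * The semidirect product of C_p by C_(p-1) *)

(** An internal semidirect product N ><| H is turned into an external one
    between prescribed copies R of N and D of H, by carrying the conjugation
    action of H on N over to an action of D on R. *)
Section TransportedAction.

Local Open Scope group_scope.

Variables gT aT rT : finGroupType.
Variables (N H : {group gT}) (D : {group aT}) (R : {group rT}).
Variables (fN : {morphism R >-> gT}) (fH : {morphism D >-> gT}).
(* An action is a function on the whole carrier type; asking R and D to be
   full spares a case distinction outside of them. *)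
Hypotheses (fullD : forall k, k \in D) (fullR : forall u, u \in R).
Hypotheses (injN : 'injm fN) (injH : 'injm fH).
Hypotheses (imN : fN @* R = N) (imH : fH @* D = H).
Hypothesis nNH : H \subset 'N(N).

Definition transported_act (u : rT) (k : aT) : rT :=
  invm injN (fN u ^ fH k).

Lemma transported_actE u k : fN (transported_act u k) = fN u ^ fH k.
Proof.
rewrite /transported_act invmK // imN memJ_norm.
  by rewrite -imN mem_morphim.
by have := subsetP nNH (fH k); rewrite -imH mem_morphim //; apply.
Qed.

Lemma transported_is_action : is_action D transported_act.
Proof.
have injf : injective fN by move=> u v; apply: (injmP injN).
split=> [k u v /(congr1 fN)|u k l _ _].
  by rewrite !transported_actE => /conjg_inj/injf.
by apply: injf; rewrite !transported_actE morphM // conjgM.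
Qed.

Lemma transported_is_groupAction :
  is_groupAction R (Action transported_is_action).
Proof.
have injf : injective fN by move=> u v; apply: (injmP injN).
move=> k _; rewrite inE; apply/andP; split.
  by apply/subsetP=> u _; apply: fullR.
apply/morphicP=> u v _ _; rewrite !actpermE /=.
by apply: injf; rewrite morphM // !transported_actE morphM // conjMg.
Qed.

Definition transported_gact : groupAction D R :=
  GroupAction transported_is_groupAction.

Lemma transported_morph_act :
  {in R & D, morph_act transported_gact 'J fN fH}.
Proof. by move=> u k _ _; rewrite /= transported_actE. Qed.

Lemma transported_isog (G : {group gT}) :
  N ><| H = G -> G \isog [set: sdprod_by transported_gact].
Proof.
case/sdprodP=> _ defG _ tiNH; rewrite isog_sym; apply/isogP.
exists (xsdprod_morphism transported_morph_act).
  by rewrite injm_xsdprodm injN injH imN imH tiNH eqxx.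
by rewrite im_xsdprodm imN imH.
Qed.

Lemma transported_faithful :
  'C_H(N) = 1 -> [faithful D, on R | transported_gact].
Proof.
move=> cHN; apply/subsetP=> k /setIP[Dk fixk]; rewrite inE.
have : fH k \in 'C_H(N).
  rewrite inE -{1}imH mem_morphim //=; apply/centP=> y.
  rewrite -imN => /morphimP[u _ Ru ->].
  have /= fixu := astab_act fixk Ru.
  by apply/esym/commgP/conjg_fixP; rewrite -transported_actE fixu.
rewrite cHN => /set1gP fk1; apply/eqP/(injmP injH); rewrite ?fullD //.
by rewrite fk1 morph1.
Qed.

End TransportedAction.

(** The normal subgroup of order p has a complement H by Schur-Zassenhaus.
    Since C_H(N) = 1, conjugation embeds H in the automorphism group of a group
    of order p, which is cyclic, so H itself is cyclic of order p - 1. *)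
Lemma holomorph_Cp (gT : finGroupType) (G N : {group gT}) (p : nat) :
  prime p -> (2 < p)%N -> #|G| = (p * p.-1)%N -> (N <| G)%g -> #|N| = p ->
  ('C_G(N) \subset N)%g ->
  exists2 to : groupAction (Zp p.-1) (Zp p),
    [faithful Zp p.-1, on Zp p | to]%g & (G \isog [set: sdprod_by to])%g.
Proof.
move=> p_pr p_gt2 cardG nNG cardN sCN.
have iGN : #|G : N|%g = p.-1.
  by rewrite -divgS ?normal_sub // cardG cardN mulKn // prime_gt0.
have hallN : Hall G N.
  rewrite /Hall normal_sub //= iGN cardN.
  by case: (p) p_gt2 => // q _; rewrite coprimeSn.
have /splitsP[H /complP[tiNH defG]] := SchurZassenhaus_split hallN nNG.
have sHG : H \subset G by rewrite -defG mulG_subr.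
have nNH : (H \subset 'N(N))%g := subset_trans sHG (normal_norm nNG).
have sdG : (N ><| H = G)%g by rewrite sdprodE.
have cHN : ('C_H(N) = 1)%g.
  apply/trivgP; rewrite -tiNH subsetI subsetIl andbT.
  by apply: subset_trans sCN; rewrite setSI.
have cycH : cyclic H.
  have injc : ('injm (restrm nNH (conj_aut N)))%g.
    by rewrite ker_restrm ker_conj_aut cHN.
  rewrite -(injm_cyclic injc) // morphim_restrm setIid.
  by apply: cyclicS (Aut_conj_aut N H) _; apply: Aut_prime_cyclic; rewrite cardN.
have cycN : cyclic N by apply: prime_cyclic; rewrite cardN.
have [x defN] := cyclicP cycN; have [h defH] := cyclicP cycH.
have ox : #[x]%g = p by rewrite orderE -defN.
have oh : #[h]%g = p.-1.
  rewrite orderE -defH -iGN -divgS ?normal_sub // -defG TI_cardMg //.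
  by rewrite mulKn.
rewrite -oh -ox.
have ox1 : (1 < #[x]%g)%N by rewrite ox prime_gt1.
have oh1 : (1 < #[h]%g)%N by rewrite oh; case: (p) p_gt2.
have fullx u : u \in Zp #[x]%g by rewrite /Zp ox1 inE.
have fullh u : u \in Zp #[h]%g by rewrite /Zp oh1 inE.
have imx : (@Zpm _ x @* Zp #[x] = N)%g by rewrite im_Zpm.
have imh : (@Zpm _ h @* Zp #[h] = H)%g by rewrite im_Zpm.
exists (transported_gact fullh fullx (injm_Zpm x) imx imh nNH).
  by apply: transported_faithful => //; apply: injm_Zpm.
by apply: transported_isog => //; apply: injm_Zpm.
Qed.

(** All that the structure of the Galois group contributes to the forward
    direction: generated by a subgroup of odd order and one more element, it has
    at most one subgroup of index 2. *)
Lemma sdprod_by_odd_cyclic (gT : finGroupType) (G : {group gT}) (m n : nat)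
    (to : groupAction (Zp m) (Zp n)) :
  (1 < n)%N -> odd n -> (G \isog [set: sdprod_by to])%g ->
  exists (N : {group gT}) (g : gT), odd #|N| /\ (G = N * <[g]> :> {set gT})%g.
Proof.
move=> n_gt1 odd_n; rewrite isog_sym => /isogP[f injf imf].
have fullf (A : {set sdprod_by to}) : A \subset [set: sdprod_by to] by rewrite subsetT.
exists (f @* (sdpair1 to @* Zp n))%G.
have [a aE] : exists a, Zp m = <[a]>%g.
  rewrite /Zp; case: ifP => _; first by exists (Zp1 : 'Z_m); rewrite -Zp_cycle.
  by exists (1%g); rewrite cycle1.
exists (f (sdpair2 to a)); split.
  rewrite /= card_injm // card_injm ?injm_sdpair1 // card_Zp //; exact: ltnW.
have aZ : a \in Zp m by rewrite aE cycle_id.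
rewrite -imf -morphim_cycle ?inE // -morphim_cycle // -aE -morphimMl ?fullf //=.
by rewrite im_sdpair.
Qed.

Local Open Scope ring_scope.

(** * Roots of unity and the square root of p* *)

(** The quotients by t of the roots of X^p - t^p are p distinct p-th roots of
    unity. *)
Lemma prim_root_of_split (F : fieldType) (p : nat) (t : F) (s : seq F) :
  (0 < p)%N -> p%:R != 0 :> F -> t != 0 ->
  'X^p - (t ^+ p)%:P %| \prod_(x <- s) ('X - x%:P) ->
  exists z : F, p.-primitive_root z.
Proof.
move=> p_gt0 pN0 tN0 /dvdp_prod_XsubC[m Dm].
set r := mask m s in Dm.
have tpN0 : t ^+ p != 0 by rewrite expf_neq0.
have monD : 'X^p - (t ^+ p)%:P \is monic by rewrite monicXnsubC.
have eqD : 'X^p - (t ^+ p)%:P = \prod_(x <- r) ('X - x%:P).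
  by apply/eqP; rewrite -eqp_monic // monic_prod_XsubC.
have sepD : separable_poly ('X^p - (t ^+ p)%:P).
  rewrite unlock derivB derivXn derivC subr0 -scaler_nat.
  rewrite coprimepZr // coprimep_expr //.
  rewrite coprimepX rootE !hornerE expr0n gtn_eqF // sub0r oppr_eq0 //.
have uniq_r : uniq r by rewrite -separable_prod_XsubC -eqD.
have size_r : size r = p.
  have := size_prod_XsubC r id; rewrite -eqD size_XnsubC //=.
  by case.
have root_r x : x \in r -> x ^+ p = t ^+ p.
  rewrite -root_prod_XsubC -eqD rootE !hornerE.
  by rewrite subr_eq0 => /eqP.
have /hasP[z _ z_prim] : has p.-primitive_root [seq x / t | x <- r].
  apply: has_prim_root => //; last by rewrite size_map size_r.
    apply/allP=> _ /mapP[x /root_r xp ->].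
    by rewrite unity_rootE expr_div_n xp divff.
  by rewrite map_inj_uniq // => x y /(mulIf _)->//; rewrite invr_neq0.
by exists z.
Qed.

(** This is (X^p - 1) / (X - 1), both factored and expanded, evaluated at 1. *)
Lemma prod_one_sub_prim_root (F : fieldType) (p : nat) (z : F) :
  (0 < p)%N -> p.-primitive_root z -> \prod_(1 <= i < p) (1 - z ^+ i) = p%:R.
Proof.
move=> p_gt0 z_prim.
have := factor_Xn_sub_1 z_prim; rewrite subrX1 big_ltn // expr0.
have X1N0 : 'X - 1%:P != 0 :> {poly F} by rewrite polyXsubC_eq0.
move/(mulfI X1N0).
move/(congr1 (horner^~ 1)); rewrite horner_prod horner_sum => E.
transitivity (\sum_(i < p) ('X^i).[1 : F]); last first.
  by under eq_bigr do rewrite hornerXn expr1n; rewrite sumr_const card_ord.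
by rewrite -E; apply: eq_bigr => i _; rewrite !hornerE.
Qed.

(** For p odd and z a primitive p-th root of unity, w = z^((p+1)/2) is the
    square root of z among the p-th roots of unity. The product of the
    w^i - w^-i over 0 < i <= (p-1)/2 is, like a quadratic Gauss sum, a square
    root of (-1)^((p-1)/2) p. This form shows how it behaves under inversion
    of z. *)
Definition sqrt_pstar (F : fieldType) (p : nat) (z : F) :=
  \prod_(1 <= i < p./2.+1) (z ^+ (p./2.+1 * i) - z ^- (p./2.+1 * i)).

(** The square of w^i - w^-i is -(1 - z^i)(1 - z^-i), and the factors
    1 - z^-i = 1 - z^(p-i) supply the second half of the product of all
    1 - z^j, whose value is p. *)
Lemma sqrt_pstarK (F : fieldType) (p : nat) (z : F) :
  odd p -> p.-primitive_root z -> sqrt_pstar p z ^+ 2 = (-1) ^+ p./2 * p%:R.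
Proof.
move=> odd_p z_prim.
have p_gt0 : (0 < p)%N by case: (p) odd_p.
have Dp : p = (p./2 + p./2).+1 by rewrite addnn -{1}(odd_double_half p) odd_p.
have zN0 : z != 0 by rewrite (prim_root_eq0 z_prim) -lt0n.
rewrite -(prod_one_sub_prim_root p_gt0 z_prim) /sqrt_pstar -prodrXl.
rewrite (@big_cat_nat _ _ _ p./2.+1 1 p) //=; last by rewrite [X in (_ <= X)%N]Dp ltnS leq_addr.
have -> : \prod_(p./2.+1 <= i < p) (1 - z ^+ i) =
          \prod_(1 <= i < p./2.+1) (1 - z ^- i).
  rewrite -[p./2.+1 in LHS]add1n big_addn.
  rewrite (_ : (p - p./2 = p./2.+1)%N); last by rewrite {1}Dp subSn ?leq_addr // addnK.
  rewrite big_nat_rev /=; apply: eq_big_nat => i /andP[i_gt0 i_lt].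
  congr (1 - _); apply: (mulIf (expf_neq0 i zN0)) => //.
  rewrite -exprD mulVf ?expf_neq0 ?zN0 //.
  rewrite (_ : (_ + i)%N = p) ?(prim_expr_order z_prim) //.
  by rewrite add1n [in RHS]Dp; lia.
have -> : (-1) ^+ p./2 = \prod_(1 <= i < p./2.+1) (-1) :> F.
  by rewrite prodr_const_nat subn1.
rewrite -!big_split /=; apply: eq_bigr => i _.
have -> : z ^+ i = (z ^+ (p./2.+1 * i)) ^+ 2.
  have Di : (p./2.+1 * i * 2 = p * i + i)%N.
    by move: (p./2) Dp => m ->; lia.
  by rewrite -exprM Di exprD exprM (prim_expr_order z_prim) expr1n mul1r.
have : z ^+ (p./2.+1 * i) != 0 by rewrite expf_neq0.
move: (z ^+ (_ * i)) => v vN0; by field.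
Qed.

Lemma sqrt_pstar_inv (F : fieldType) (p : nat) (z : F) :
  sqrt_pstar p z^-1 = (-1) ^+ p./2 * sqrt_pstar p z.
Proof.
have -> : (-1) ^+ p./2 = \prod_(1 <= i < p./2.+1) (-1) :> F.
  by rewrite prodr_const_nat subn1.
rewrite -big_split /=; apply: eq_bigr => i _.
by rewrite !exprVn invrK mulN1r opprB.
Qed.

Lemma rmorph_sqrt_pstar (F K : fieldType) (h : {rmorphism F -> K}) p z :
  h (sqrt_pstar p z) = sqrt_pstar p (h z).
Proof.
rewrite rmorph_prod; apply: eq_bigr => i _.
by rewrite rmorphB fmorphV !rmorphXn.
Qed.

(** * Quadratic elements of a splitting field *)

Lemma galois_over_rat (L : splittingFieldType rat) : galois 1 {:L}.
Proof.
apply/and3P; split; [exact: sub1v | | exact: normalFieldf].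
apply/separableP=> y _; apply: pcharf0_separable.
by move=> q; rewrite pchar_lalg pchar_num.
Qed.

Lemma fixed_by_gal_rat (L : splittingFieldType rat) (x : L) :
  (forall s, s \in 'Gal({:L} / 1)%g -> s x = x) -> x \in 1%VS.
Proof.
move=> fix_x; rewrite -(galois_fixedField (galois_over_rat L)).
apply/fixedFieldP; first exact: memvf.
exact: fix_x.
Qed.

(** A square root of a rational number is fixed or negated by each
    automorphism, and is fixed by automorphisms of odd order. When the Galois
    group is N <[g]> with N of odd order, its behaviour is therefore decided
    by g alone. *)
Section QuadraticSubfields.

Variables (L : splittingFieldType rat) (N : {group gal_of {:L}}).
Variable g : gal_of {:L}.
Hypotheses (oddN : odd #|N|) (defG : ('Gal({:L} / 1) = N * <[g]> :> {set _})%g).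

Let gal1 (s : gal_of {:L}) x : x \in 1%VS -> s x = x.
Proof. by case/vlineP=> k ->; rewrite linearZ /= rmorph1. Qed.

Let galX (s : gal_of {:L}) k x : s x = x -> (s ^+ k)%g x = x.
Proof.
move=> sx; elim: k => [|k IHk]; first by rewrite expg0 gal_id.
by rewrite expgS galM ?memvf // sx.
Qed.

Lemma gal_quadratic (s : gal_of {:L}) d :
  d ^+ 2 \in 1%VS -> s d = d \/ s d = - d.
Proof.
move/(gal1 s)/eqP; rewrite rmorphXn -subr_eq0 subr_sqr mulf_eq0.
by rewrite subr_eq0 addr_eq0 => /orP[]/eqP; [left | right].
Qed.

Lemma gal_quadratic_odd d s : d ^+ 2 \in 1%VS -> s \in N -> s d = d.
Proof.
move=> dQ Ns; case: (gal_quadratic s dQ) => // sd.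
have ss : (s ^+ 2)%g d = d by rewrite expgS expg1 galM ?memvf // sd raddfN /= sd opprK.
have : (s ^+ #|N|)%g d = d by rewrite expg_cardG ?gal_id.
rewrite -[#|N|]odd_double_half oddN -mul2n expgD expg1 expgM galM ?memvf // sd.
by rewrite raddfN /= galX // => <-.
Qed.

Lemma quadratic_rational d : d ^+ 2 \in 1%VS -> g d = d -> d \in 1%VS.
Proof.
move=> dQ gd; apply: fixed_by_gal_rat => s; rewrite defG => /mulsgP[x y Nx].
case/cycleP=> k -> ->; rewrite galM ?memvf // (gal_quadratic_odd dQ Nx).
exact: galX.
Qed.

(** If g negates both d and e, it fixes their product. *)
Lemma two_quadratics (d e : L) : d ^+ 2 \in 1%VS -> e ^+ 2 \in 1%VS ->
  [\/ d \in 1%VS, e \in 1%VS | d * e \in 1%VS].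
Proof.
move=> dQ eQ.
have [gd|gd] := gal_quadratic g dQ; first by constructor 1; apply: quadratic_rational.
have [ge|ge] := gal_quadratic g eQ; first by constructor 2; apply: quadratic_rational.
constructor 3; apply: quadratic_rational; first by rewrite exprMn rpredM.
by rewrite rmorphM /= gd ge mulrNN.
Qed.

End QuadraticSubfields.

Lemma sqr_rat_int (q : rat) (n : int) : q ^+ 2 = n%:~R -> exists k : nat, n = (k ^ 2)%:Z.
Proof.
move=> q2; have : numq q ^+ 2 = n * denq q ^+ 2.
  apply: (intr_inj (R := rat)); rewrite rmorphXn rmorphM /= -q2 rmorphXn.
  by rewrite numqE exprMn.
move=> Dn; have cop : coprimez (denq q ^+ 2) (numq q ^+ 2).
  by rewrite coprimezXl // coprimezXr // coprimez_sym /coprimez; have := coprime_num_den q.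
have : (denq q ^+ 2 %| 1)%Z.
  rewrite -(Gauss_dvdzr _ cop) mulr1 Dn; exact: dvdz_mull.
rewrite dvdz1 => /eqP d1.
have {}d1 : denq q ^+ 2 = 1 by have := denq_gt0 q; lia.
exists `|numq q|%N; move: Dn; rewrite d1 mulr1 => <-; lia.
Qed.

Lemma sqr_in_rat (L : fieldExtType rat) (x : L) (n : int) :
  x \in 1%VS -> x ^+ 2 = n%:~R -> exists k : nat, n = (k ^ 2)%:Z.
Proof.
case/vlineP=> q -> E; apply: (@sqr_rat_int q).
apply: (fmorph_inj (in_alg L)); rewrite rmorphXn rmorph_int; exact: E.
Qed.

(** * The trinomial and its quadratic resolvent *)

Lemma natr_fieldExt_neq0 (L : fieldExtType rat) (n : nat) :
  (0 < n)%N -> n%:R != 0 :> L.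
Proof.
by move=> n_gt0; rewrite -(rmorph_nat (in_alg L)) fmorph_eq0 pnatr_eq0 gtn_eqF.
Qed.

Definition trinomial (p a : nat) : {poly int} := 'X^(2 * p) + a%:Z *: 'X^p - 1.

Lemma map_trinomial (R : nzRingType) p a :
  map_poly intr (trinomial p a) = 'X^(2 * p) + a%:R *: 'X^p - 1 :> {poly R}.
Proof. by rewrite rmorphB rmorphD /= map_polyZ !map_polyXn rmorph1. Qed.

Lemma root_trinomial (R : comNzRingType) p a (x : R) :
  root (map_poly intr (trinomial p a)) x = (x ^+ p * (x ^+ p + a%:R) == 1).
Proof.
rewrite rootE map_trinomial !hornerE subr_eq0 mulnC exprM.
by rewrite expr2 mulrDr [a%:R * _]mulrC.
Qed.

(** Here t is a root of Y^2 + cY - 1, and 2t + c is the square root of the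
    discriminant given by the quadratic formula. *)
Lemma root_quadratic_disc (R : comNzRingType) (t c : R) :
  t * (t + c) = 1 -> (t *+ 2 + c) ^+ 2 = c ^+ 2 + 4%:R.
Proof.
move=> t1; have -> : (t *+ 2 + c) ^+ 2 = c ^+ 2 + 4%:R * (t * (t + c)) by ring.
by rewrite t1 mulr1.
Qed.

Lemma size_trinomial p a : (0 < p)%N -> size (trinomial p a) = (2 * p).+1.
Proof.
move=> p_gt0; rewrite /trinomial -addrA size_polyDl size_polyXn //.
apply: leq_ltn_trans (size_polyD _ _) _; rewrite gtn_max size_polyN size_poly1.
rewrite (leq_ltn_trans (size_scale_leq _ _)) ?size_polyXn //; lia.
Qed.

Lemma trinomial_monic p a : (0 < p)%N -> trinomial p a \is monic.
Proof.
move=> p_gt0; rewrite monicE lead_coefE size_trinomial //= /trinomial.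
have /negPf neq_p : (2 * p != p)%N by lia.
have /negPf neq_0 : (2 * p != 0)%N by lia.
by rewrite coefB coefD coefZ !coefXn coef1 eqxx neq_p neq_0 mulr0 addr0 subr0.
Qed.

(** With y = theta^p, the trinomial is (X^p - y)(X^p + y + a); the first factor
    splits, and this provides the p-th roots of unity. *)
Lemma trinomial_splits (L : fieldExtType rat) (p a : nat) :
  prime p -> splittingFieldFor 1 (map_poly intr (trinomial p a)) {:L} ->
  exists theta z : L,
    root (map_poly intr (trinomial p a)) theta /\ p.-primitive_root z.
Proof.
move=> p_pr [rs Drs _]; have p_gt0 := prime_gt0 p_pr.
have [theta th_root] : exists theta : L, root (map_poly intr (trinomial p a)) theta.
  case: rs Drs => [|x rs] Drs; last first.
    by exists x; rewrite (eqp_root Drs) root_prod_XsubC mem_head.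
  move: (eqp_size Drs); rewrite big_nil size_poly1 size_map_poly_id0.
    by rewrite size_trinomial //; lia.
  by rewrite (eqP (trinomial_monic a p_gt0)) oner_eq0.
exists theta; move: (th_root); rewrite root_trinomial => /eqP th1.
have thN0 : theta != 0.
  apply: contra_eq_neq th1 => ->; rewrite expr0n gtn_eqF // mul0r eq_sym.
  exact: oner_neq0.
have pN0 := natr_fieldExt_neq0 L p_gt0.
have [|z z_prim] := @prim_root_of_split L p theta rs p_gt0 pN0 thN0.
  rewrite -(eqp_dvdr _ Drs); apply/dvdpP.
  exists ('X^p + (theta ^+ p + a%:R)%:P).
  rewrite map_trinomial mulnC exprM -mul_polyC.
  move: (theta ^+ p) (a%:R) th1 => t c th1.
  by rewrite -[1]/(1%:P) -th1 polyCM !polyCD; ring.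
by exists z; split=> //; apply/eqP.
Qed.

(** The square roots d of a^2 + 4 and e of p* both lie in L, so one of d, e, d e
    is rational. Neither a^2 + 4 nor +-p is a square, which leaves d e: then
    p* (a^2 + 4) is a square, p* is positive, and p divides a^2 + 4. *)
Lemma trinomial_disc (L : splittingFieldType rat) (p a : nat)
    (N : {group gal_of {:L}}) (g : gal_of {:L}) :
  prime p -> odd p -> (0 < a)%N ->
  splittingFieldFor 1 (map_poly intr (trinomial p a)) {:L} ->
  odd #|N| -> ('Gal({:L} / 1) = N * <[g]> :> {set _})%g ->
  exists s : nat, (a ^ 2 + 4 = p * s ^ 2)%N.
Proof.
move=> p_pr odd_p a_gt0 /(trinomial_splits p_pr)[theta [z [+ z_prim]]] oddN defG.
rewrite root_trinomial => /eqP th1.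
set d := theta ^+ p *+ 2 + a%:R; set e := sqrt_pstar p z.
have d2 : d ^+ 2 = (a ^ 2 + 4)%:Z%:~R.
  by rewrite -pmulrn natrD natrX (root_quadratic_disc th1).
have e2 : e ^+ 2 = ((-1) ^+ p./2 * p%:Z)%:~R.
  by rewrite sqrt_pstarK // rmorphM rmorphXn rmorphN1.
have dQ : d ^+ 2 \in 1%VS by rewrite d2 rpred_int.
have eQ : e ^+ 2 \in 1%VS by rewrite e2 rpred_int.
case: (two_quadratics oddN defG dQ eQ).
(* a^2 + 4 = k^2 with k > a is impossible: k = a + 1 fails by parity, and
   k >= a + 2 makes k^2 too large. *)
- move/sqr_in_rat=> /(_ _ d2)[k /eqP]; rewrite eqz_nat => /eqP Dk.
  have lt_ak : (a < k)%N by rewrite -ltn_sqr -Dk; lia.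
  have [j Dj] : exists j, k = (a.+1 + j)%N by exists (k - a.+1)%N; lia.
  have {}Dk : (2 * a + 1 + j * (2 * a + 2 + j) = 4)%N by rewrite Dj in Dk; lia.
  case: j Dk {Dj} => [|j]; first by lia.
  by rewrite (mulSn j); move: (j * _)%N => r; lia.
- move/sqr_in_rat=> /(_ _ e2)[k]; rewrite -signr_odd.
  case: (odd _); rewrite ?expr1 ?expr0 ?mulN1r ?mul1r => Dk; first by have := prime_gt0 p_pr; lia.
  have {}Dk : p = (k ^ 2)%N by lia.
  have /primeP[p_gt1 /(_ k)] := p_pr; rewrite {1}Dk dvdn_mulr // => /(_ isT).
  by case/orP=> /eqP; nia.
move/sqr_in_rat=> H.
have [k] : exists k : nat, (a ^ 2 + 4)%:Z * ((-1) ^+ p./2 * p%:Z) = (k ^ 2)%:Z.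
  by apply: H; rewrite exprMn d2 e2 -rmorphM.
rewrite -signr_odd; case: (odd _); rewrite ?expr1 ?expr0 ?mulN1r ?mul1r => Dk.
  by have := prime_gt0 p_pr; nia.
have {}Dk : ((a ^ 2 + 4) * p = k ^ 2)%N by lia.
have /dvdnP[s Ds] : (p %| k)%N.
  have : (p %| k ^ 2)%N by rewrite -Dk dvdn_mull.
  by rewrite Euclid_dvdX // andbT.
exists s; apply/eqP; rewrite -(eqn_pmul2r (prime_gt0 p_pr)) Dk Ds; apply/eqP; lia.
Qed.

(** Serves to exclude elements from M: coordinates are unique, so those of
    x *~ k are k times those of x. *)
Lemma Zbasis_dvd (V : zmodType) (M : V -> Prop) (n : nat) (b : 'I_n -> V)
    (x : V) (k : int) (e : 'I_n -> int) :
  Zbasis M b -> M x -> x *~ k = \sum_(i < n) b i *~ e i ->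
  forall i, (k %| e i)%Z.
Proof.
move=> [genM freeb] /genM[c ->] Dk i.
have := freeb (fun i => e i - c i * k); rewrite (_ : \sum_(i < n) _ = 0).
  by move/(_ erefl i)/eqP; rewrite subr_eq0 => /eqP->; apply: dvdz_mull.
under eq_bigr do rewrite mulrzBr mulrzA.
by rewrite sumrB -Dk mulrz_suml subrr.
Qed.

(** With d = 2 theta^p + a, the algebraic integers d/s and, when s = 2,
    (1 + d/2)/2 have the coordinates 2/s and 1/2 on theta^p. *)
Lemma monogenic_trinomial_disc (L : fieldExtType rat) (theta : L) (p a s : nat) :
  prime p -> odd p -> monogenic (trinomial p a) ->
  root (map_poly intr (trinomial p a)) theta ->
  (a ^ 2 + 4 = p * s ^ 2)%N -> s = 1%N.
Proof.
move=> p_pr odd_p [_ _ mono] th_root Ds.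
have p_gt0 := prime_gt0 p_pr.
have /mono basis := th_root.
move: th_root; rewrite root_trinomial => /eqP th1.
have p_lt : (p < (size (trinomial p a)).-1)%N by rewrite size_trinomial //=; lia.
have o_lt : (0 < (size (trinomial p a)).-1)%N by rewrite size_trinomial //=; lia.
set E := <<1; theta>>%AS in basis.
have thE : theta \in E by apply: memv_adjoin.
have nE (n : nat) : n%:R \in E by apply: rpred_nat.
(* Only the coordinate 2 on theta^p serves as an obstruction; the constant
   coordinate m differs between the two elements tested below. *)
have key (k m : nat) (x : L) : ring_of_integers E x ->
    x *~ k%:Z = theta ^+ p *+ 2 + m%:R -> (k %| 2)%N.
  move=> Ox Dx.
  pose ip := Ordinal p_lt; pose io := Ordinal o_lt.
  pose e (i : 'I_(size (trinomial p a)).-1) : int :=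
    (i == ip)%:R *+ 2 + (i == io)%:R *+ m.
  have := @Zbasis_dvd _ _ _ _ x k%:Z e basis Ox; rewrite Dx => /(_ _ ip).
  rewrite /e eqxx (_ : (ip == io) = false); last by apply/eqP => /(congr1 val)/= p0; lia.
  rewrite mul0rn addr0; apply.
  have single (j : 'I_(size (trinomial p a)).-1) (n : nat) :
      \sum_(i < (size (trinomial p a)).-1) theta ^+ i *~ ((i == j)%:R *+ n) = theta ^+ j *+ n.
    rewrite (bigD1 j) //= eqxx -[_ *+ n]mulr_natr mul1r natz big1 ?addr0 // => i /negPf->.
    by rewrite mul0rn.
  under eq_bigr do rewrite mulrzDr.
  by rewrite big_split /= !single expr0.
have mulrnat (x : L) (n : nat) : x *~ n%:Z = x * n%:R by rewrite mulr_natr.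
set d := theta ^+ p *+ 2 + a%:R.
have d2 : d ^+ 2 = p%:R * s%:R ^+ 2.
  by rewrite -natrX -natrM -Ds natrD natrX (root_quadratic_disc th1).
have dE : d \in E by rewrite rpredD ?nE // rpredMn // rpredX.
have natN0 := @natr_fieldExt_neq0 L.
have s_gt0 : (0 < s)%N by move: Ds; case: (s) => //; rewrite muln0; lia.
have sN0 := natN0 s s_gt0.
have s_dvd2 : (s %| 2)%N.
  apply: (key s a (d / s%:R)); last by rewrite mulrnat divfK.
  split; first by rewrite rpred_div ?nE.
  exists ('X^2 - (p%:Z)%:P); first exact: monicXnsubC.
  rewrite rootE rmorphB /= map_polyXn map_polyC /= !hornerE expr_div_n d2.
  by rewrite mulfK ?subrr // expf_neq0.
have : (s <= 2)%N by apply: dvdn_leq s_dvd2.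
case: (ltngtP s 2) => // [s_lt _|s2 _]; first by lia.
rewrite s2 in d2 Ds.
(* With s = 2, a = 2b and p = b^2 + 1; as p is odd, b is even. *)
have [k Dk] : exists k : nat, p = (4 * k + 1)%N.
  have [b Db] : exists b, a = (2 * b)%N.
    have a_even : ~~ odd a.
      by have := congr1 odd Ds; rewrite oddD oddX oddM /= andbF addbF => ->.
    by exists a./2; rewrite mul2n -[LHS]odd_double_half (negPf a_even).
  have Dp : p = (b ^ 2 + 1)%N by move: Ds; rewrite Db expnMn; lia.
  have [c Dc] : exists c, b = (2 * c)%N.
    exists (b./2); rewrite mul2n -[LHS]odd_double_half.
    by move: odd_p; rewrite Dp addn1 /= oddX /= => /negPf->.
  by exists (c ^ 2)%N; rewrite Dp Dc expnMn.
have N2 := natN0 2 isT.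
suff : (4 %| 2)%N by [].
apply: (key 4 (a + 2)%N ((1 + d / 2%:R) / 2%:R)); last first.
  by rewrite mulrnat /d natrD; field.
split; first by rewrite rpred_div ?rpredD ?rpred1 ?rpred_div ?nE.
(* Since (d/2)^2 = p = 4k + 1, this element is a root of X^2 - X - k. *)
exists ('X^2 - ('X + k%:Z%:P)).
  rewrite monicE lead_coefDl ?lead_coefXn //.
  by rewrite size_polyN size_polyXn size_XaddC.
rewrite rootE rmorphB rmorphD /= map_polyXn map_polyX map_polyC /= !hornerE.
have -> : ((1 + d / 2%:R) / 2%:R) ^+ 2 =
   1 / 4%:R + d / 4%:R + d ^+ 2 / 16%:R :> L by field; rewrite ?natN0.
rewrite d2 -pmulrn Dk natrD natrM; apply/eqP.
by field; rewrite ?natN0.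
Qed.

(** * Reduction modulo a prime *)

Local Notation reduction q := (map_poly (intr : int -> 'F_q)).

Lemma intr_Fp_eq0 (q : nat) (n : int) :
  prime q -> (n%:~R == 0 :> 'F_q) = (q%:Z %| n)%Z.
Proof. by move=> q_pr; rewrite (dvdz_pcharf (pchar_Fp q_pr)). Qed.

Lemma reduction_surj (q : nat) (u : {poly 'F_q}) : exists v, reduction q v = u.
Proof.
exists (map_poly (fun x : 'F_q => (x : nat)%:Z) u).
apply/polyP=> i; rewrite !coef_map_id0 ?rmorph0 //.
exact: natr_Zp.
Qed.

Lemma reduction_eq0 (q : nat) (g : {poly int}) :
  prime q -> reduction q g = 0 -> exists v, g = q%:Z *: v.
Proof.
move=> q_pr /polyP g0; exists (map_poly (divz^~ q) g).
apply/polyP=> i; rewrite coefZ coef_map_id0 ?div0z //.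
by rewrite mulrC divzK // -intr_Fp_eq0 //; have := g0 i; rewrite coef_map coef0 /= => ->.
Qed.

Lemma reduction_dvd (q : nat) (f g : {poly int}) :
  prime q -> reduction q f %| reduction q g ->
  exists u v, g = u * f + q%:Z *: v.
Proof.
move=> q_pr /dvdpP[w]; have [u <-] := reduction_surj w => Dg.
have [|v Dv] := @reduction_eq0 q (g - u * f) q_pr.
  by rewrite rmorphB rmorphM /= Dg subrr.
by exists u, v; rewrite -Dv addrC subrK.
Qed.

Lemma reduction_horner (q : nat) (g : {poly int}) (c : int) :
  (reduction q g).[c%:~R] = g.[c]%:~R.
Proof. exact: horner_map. Qed.

(** Eisenstein's criterion, without moving c to 0: in a factorisation f = g h
    both factors reduce to positive powers of X - c, so p divides both g(c) and
    h(c), and p^2 divides f(c). *)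
Lemma totally_ramified_irreducible (p n : nat) (f : {poly int}) (c : int) :
  prime p -> f \is monic -> (1 < size f)%N ->
  reduction p f = ('X - c%:~R%:P) ^+ n -> ~~ ((p ^ 2)%:Z %| f.[c])%Z ->
  irreducible_poly (map_poly (intr : int -> rat) f).
Proof.
move=> p_pr mon_f f_gt1 red_f ndvd_fc; split; first by rewrite size_rat_int_poly.
move=> f' f'_neq1 /dvdpP_rat_int[g [d dN0 Df'] [h Df]].
move: f'_neq1; rewrite {f'}Df' size_scale // size_rat_int_poly => g_neq1.
apply: eqp_trans (eqp_scale _ dN0) _; rewrite Df rmorphM /=.
have lc_gh : lead_coef g * lead_coef h = 1 by rewrite -lead_coefM -Df (eqP mon_f).
have dvd_root (u : {poly int}) : size u != 1%N -> (lead_coef u)%:~R != 0 :> 'F_p ->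
    reduction p u %| reduction p f -> (p%:Z %| u.[c])%Z.
  move=> u_neq1 lcu; rewrite red_f => /dvdp_exp_XsubCP[k _ Du].
  rewrite -intr_Fp_eq0 // -reduction_horner -/(root _ _) (eqp_root Du).
  have : size (reduction p u) != 1%N by rewrite size_map_poly_id0.
  rewrite (eqp_size Du); case: k {Du} => [|k _]; first by rewrite expr0 size_poly1.
  by rewrite root_exp_XsubC eqxx.
have lcF : (lead_coef g)%:~R * (lead_coef h)%:~R = 1 :> 'F_p by rewrite -rmorphM lc_gh.
have [h1|h_neq1] := eqVneq (size h) 1%N.
  have /size_poly1P[e eN0 ->] : size h == 1%N by rewrite h1.
  by rewrite map_polyC mulrC mul_polyC eqp_sym eqp_scale //= intr_eq0.
case/negP: ndvd_fc; rewrite Df hornerM.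
have -> : (p ^ 2)%:Z = p%:Z * p%:Z by rewrite -PoszM.
apply: dvdz_mul.
  apply: dvd_root => //; last by rewrite Df rmorphM dvdp_mulIl.
  by apply: contra_eq_neq lcF => ->; rewrite mul0r eq_sym oner_neq0.
apply: dvd_root => //; last by rewrite Df rmorphM dvdp_mulIr.
by apply: contra_eq_neq lcF => ->; rewrite mulr0 eq_sym oner_neq0.
Qed.

(** Split f as d e with d = gcd(f, g). Separability makes d and e coprime, hence
    e is coprime to g, and e divides a power of g: it is constant. *)
Lemma separable_dvdp_exp (F : fieldType) (f g : {poly F}) k :
  separable_poly f -> f %| g ^+ k -> f %| g.
Proof.
move=> sep_f dvd_fgk; set d := gcdp f g.
have dvd_df : d %| f := dvdp_gcdl f g.
have Df := divpK dvd_df; set e := f %/ d in Df.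
have cop_ed : coprimep e d.
  by apply: separable_coprime sep_f _; rewrite Df.
have cop_eg : coprimep e g.
  apply/coprimepP=> r re rg; apply: (coprimepP _ _ cop_ed r re).
  by rewrite dvdp_gcd rg (dvdp_trans re) // -Df dvdp_mulr.
have e1 : e %= 1.
  rewrite -size_poly_eq1 -coprimepp.
  apply: coprimep_dvdl (coprimep_expr k cop_eg).
  by apply: dvdp_trans dvd_fgk; rewrite -Df dvdp_mulIl.
rewrite -Df; apply: dvdp_trans (dvdp_gcdr f g).
by rewrite (eqp_dvdl _ (eqp_mulr d e1)) mul1r.
Qed.

(** * Maximality of the order Z[theta] *)

(** To show that an integer x of Q(theta) is in Z[theta], write N x = g(theta)
    with N > 0 and g in Z[X], and remove the prime factors of N one at a time:
    it is enough that q x in Z[theta] implies x in Z[theta] for q prime. *)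
Section MonogenicOrder.

Variables (f : {poly int}) (L : fieldExtType rat) (theta : L).
Hypotheses (mon_f : f \is monic).
Hypothesis irr_f : irreducible_poly (map_poly (intr : int -> rat) f).
Hypothesis root_f : root (map_poly intr f) theta.

Local Notation integral := (integralOver (intr : int -> L)).

Definition zeval (g : {poly int}) : L := (map_poly intr g).[theta].

Lemma zevalD g h : zeval (g + h) = zeval g + zeval h.
Proof. by rewrite /zeval rmorphD hornerD. Qed.

Lemma zevalM g h : zeval (g * h) = zeval g * zeval h.
Proof. by rewrite /zeval rmorphM hornerM. Qed.

Lemma zevalX g n : zeval (g ^+ n) = zeval g ^+ n.
Proof. by rewrite /zeval rmorphXn horner_exp. Qed.

Lemma zevalZ c g : zeval (c *: g) = zeval g * c%:~R.
Proof. by rewrite /zeval map_polyZ hornerZ mulrC. Qed.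

Lemma zeval_min : zeval f = 0.
Proof. exact/rootP. Qed.

Lemma zeval_integral g : integral (zeval g).
Proof.
apply: integral_horner; last by exists f.
apply/integral_poly=> i; rewrite coef_map; exact: integral_id.
Qed.

(** Divisibility holds over Q as f is the minimal polynomial of theta, and it
    descends to Z because f is monic. *)
Lemma zeval_eq0 g : zeval g = 0 -> exists h, g = h * f.
Proof.
move=> g0; apply/Pdiv.IdomainMonic.dvdpP => //.
rewrite -dvdp_rat_int; set fQ := map_poly _ f; set gQ := map_poly _ g.
have in_algE (h : {poly int}) :
    map_poly (intr : int -> L) h = map_poly (in_alg L) (map_poly intr h).
  by rewrite -map_poly_comp; apply: eq_map_poly => n /=; rewrite scaler_int.
have ncop : ~~ coprimep fQ gQ.
  rewrite -(coprimep_map (in_alg L)) -!in_algE.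
  by apply: contraL root_f => /coprimep_root cop; apply: contra_eqN g0 => /cop.
have : gcdp fQ gQ %= fQ by apply: irr_f; rewrite ?dvdp_gcdl // -coprimep_def.
by rewrite /eqp => /andP[_ /dvdp_trans->]//; rewrite dvdp_gcdr.
Qed.

(** An integral equation for x = g(theta)/q of degree k, multiplied by q^k, says
    that g^k is a multiple of q in Z[theta] = Z[X]/(f): modulo q, f divides
    g^k. *)
Lemma integral_multiple_reduction (q : nat) (x : L) (g : {poly int}) :
  prime q -> integral x -> x * q%:R = zeval g ->
  exists k, reduction q f %| reduction q g ^+ k.
Proof.
move=> q_pr [P mon_P root_P] Dx; set n := (size P).-1.
have sizeP : size P = n.+1 by rewrite prednK // size_poly_gt0 monic_neq0.
pose h := \sum_(i < n.+1) (P`_i * q%:Z ^+ (n - i)) *: g ^+ i.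
have h0 : zeval h = 0.
  rewrite /zeval rmorph_sum horner_sum.
  transitivity ((map_poly intr P).[x] * q%:R ^+ n); last by rewrite (rootP root_P) mul0r.
  rewrite horner_coef size_map_poly_id0 ?(eqP mon_P) ?oner_neq0 // sizeP mulr_suml.
  apply: eq_bigr => i _; rewrite -/(zeval _) zevalZ zevalX -Dx coef_map /=.
  have -> : q%:R ^+ n = q%:R ^+ i * q%:R ^+ (n - i) :> L.
    by rewrite -exprD subnKC // -ltnS.
  by rewrite rmorphM rmorphXn /= exprMn; ring.
have [u Du] := zeval_eq0 h0; exists n; apply/dvdpP; exists (reduction q u).
rewrite -rmorphM -Du rmorph_sum /= big_ord_recr /= subnn.
rewrite (_ : P`_n = 1) ?scale1r; last by rewrite -(eqP mon_P).
rewrite big1 ?add0r ?mulr1 ?scale1r ?rmorphXn // => i _.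
rewrite -mul_polyC rmorphM /= map_polyC /= rmorphM rmorphXn /=.
have /eqP-> : q%:Z%:~R == 0 :> 'F_q by rewrite intr_Fp_eq0.
by rewrite expr0n subn_eq0 leqNgt ltn_ord mulr0 mul0r.
Qed.

(** If g = u f + q v then q x = q v(theta). *)
Lemma integral_descent_dvd (q : nat) (x : L) (g : {poly int}) :
  prime q -> x * q%:R = zeval g -> reduction q f %| reduction q g ->
  exists v, x = zeval v.
Proof.
move=> q_pr Dx /(reduction_dvd q_pr)[u [v Dg]]; exists v.
have qN0 := natr_fieldExt_neq0 L (prime_gt0 q_pr).
apply: (mulIf qN0); rewrite Dx Dg zevalD zevalM zevalZ.
by rewrite zeval_min mulr0 add0r.
Qed.

Lemma integral_descent_separable (q : nat) (x : L) (g : {poly int}) :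
  prime q -> separable_poly (reduction q f) ->
  integral x -> x * q%:R = zeval g -> exists v, x = zeval v.
Proof.
move=> q_pr sep_f int_x Dx.
have [k dvd_fgk] := integral_multiple_reduction q_pr int_x Dx.
exact: integral_descent_dvd q_pr Dx (separable_dvdp_exp sep_f dvd_fgk).
Qed.

(** Write Y = X - c and f = Y^n + p h, where p does not divide h(c). If f does
    not divide g modulo p, then g = Y^j w modulo p with j < n and w(c) <> 0.
    Multiplying x by Y^(n-1-j) and subtracting an element of Z[theta] yields an
    algebraic integer y with p y = Y^(n-1) w at theta. As Y^n = - p h at theta, the
    n-th power of this relation reads p y^n = +- h^(n-1) w^n, and then
    [integral_multiple_reduction] makes h w vanish at c modulo p. *)
Lemma integral_descent_ramified (p n : nat) (c : int) (x : L) (g : {poly int}) :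
  prime p -> reduction p f = ('X - c%:~R%:P) ^+ n ->
  ~~ ((p ^ 2)%:Z %| f.[c])%Z -> (0 < n)%N ->
  integral x -> x * p%:R = zeval g -> exists v, x = zeval v.
Proof.
move=> p_pr red_f ndvd_fc n_gt0 int_x Dx.
have [|ndvd_fg] := boolP (reduction p f %| reduction p g).
  exact: integral_descent_dvd.
set Y := 'X - c%:P : {poly int}.
have red_Y : reduction p Y = 'X - c%:~R%:P.
  by rewrite rmorphB /= map_polyX map_polyC.
have [h Df] : exists h, f = Y ^+ n + p%:Z *: h.
  have [|h Dh] := @reduction_eq0 p (f - Y ^+ n) p_pr.
    by rewrite rmorphB rmorphXn /= red_Y red_f subrr.
  by exists h; rewrite -Dh addrC subrK.
have hc : ~~ root (reduction p h) c%:~R.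
  rewrite rootE reduction_horner intr_Fp_eq0 //.
  apply: contra ndvd_fc => dvd_h; rewrite Df !hornerE subrr expr0n gtn_eqF // add0r.
  by rewrite expnS expn1 PoszM dvdz_mul.
have gN0 : reduction p g != 0 by apply: contraNneq ndvd_fg => ->.
have [j [w' + Dg]] := multiplicity_XsubC (reduction p g) c%:~R.
rewrite gN0 /= => wc.
have lt_jn : (j < n)%N.
  rewrite ltnNge; apply: contra ndvd_fg => le_nj.
  by rewrite red_f Dg dvdp_mull // dvdp_exp2l.
have [w Dw] := reduction_surj w'; rewrite -{w'}Dw in wc Dg.
have [r Dr] : exists r, g * Y ^+ (n.-1 - j) = Y ^+ n.-1 * w + p%:Z *: r.
  have [|r Dr] := @reduction_eq0 p (g * Y ^+ (n.-1 - j) - Y ^+ n.-1 * w) p_pr.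
    rewrite rmorphB !rmorphM !rmorphXn /= red_Y Dg -mulrA -exprD subnKC; last by lia.
    by rewrite mulrC subrr.
  by exists r; rewrite -Dr addrC subrK.
pose y := x * zeval (Y ^+ (n.-1 - j)) - zeval r.
have int_y : integral y.
  by apply: integral_sub; [apply: integral_mul => // | ]; apply: zeval_integral.
have Dy : y * p%:R = zeval (Y ^+ n.-1 * w).
  rewrite mulrBl mulrAC Dx -zevalM Dr zevalD zevalZ.
  by rewrite addrK.
have YnE : zeval (Y ^+ n) = - (zeval h * p%:R).
  by apply/eqP; rewrite -addr_eq0 -zeval_min Df zevalD zevalZ.
have pN0 := natr_fieldExt_neq0 L (prime_gt0 p_pr).
have Dyn : y ^+ n * p%:R = zeval ((-1) ^+ n.-1 *: (h ^+ n.-1 * w ^+ n)).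
  have pnN0 : p%:R ^+ n.-1 != 0 :> L by rewrite expf_neq0.
  apply: (mulIf pnN0); rewrite -mulrA -exprS prednK // -exprMn Dy -zevalX.
  rewrite exprMn -exprM mulnC exprM zevalM zevalX YnE zevalZ zevalM !zevalX.
  by rewrite rmorphXn rmorphN1 exprNn exprMn; ring.
have int_yn : integral (y ^+ n).
  elim: (n) => [|k IHk]; first by rewrite expr0; apply: integral1.
  by rewrite exprS; apply: integral_mul.
have [k] := integral_multiple_reduction p_pr int_yn Dyn.
move/dvdp_trans=> H.
have : root ((reduction p ((-1) ^+ n.-1 *: (h ^+ n.-1 * w ^+ n))) ^+ k) c%:~R.
  rewrite -dvdp_XsubCl; apply: dvdp_trans (H _ (dvdpp _)).
  by rewrite red_f -(prednK n_gt0) exprS dvdp_mulIl.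
rewrite map_polyZ rmorphM !rmorphXn /= rmorphN1.
rewrite rootE horner_exp hornerZ hornerM !horner_exp expf_eq0 => /andP[_].
by rewrite !mulf_eq0 signr_eq0 !expf_eq0 -!rootE (negPf hc) (negPf wc) !andbF.
Qed.

Hypothesis local_f : forall q : nat, prime q ->
  separable_poly (reduction q f) \/
  exists n (c : int), reduction q f = ('X - c%:~R%:P) ^+ n
                      /\ ~~ ((q ^ 2)%:Z %| f.[c])%Z.

Lemma integral_descent (N : nat) (x : L) (g : {poly int}) :
  (0 < N)%N -> integral x -> x * N%:R = zeval g -> exists v, x = zeval v.
Proof.
elim/ltn_ind: N x g => N IHN x g N_gt0 int_x Dx.
have [N_le1|N_gt1] := leqP N 1.
  by exists g; rewrite -Dx (_ : N = 1%N) ?mulr1 //; lia.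
have q_pr := pdiv_prime N_gt1; set q := pdiv N in q_pr.
have /dvdnP[m Dm] : (q %| N)%N := pdiv_dvd N.
have q_gt1 := prime_gt1 q_pr.
have m_gt0 : (0 < m)%N by move: N_gt0; rewrite Dm muln_gt0 => /andP[].
have ltmN : (m < N)%N by rewrite Dm; nia.
have int_xm : integral (x * m%:R) by apply: integral_mul => //; apply: integral_nat.
have Dxm : x * m%:R * q%:R = zeval g by rewrite -mulrA -natrM -Dm.
suff [v Dv] : exists v, x * m%:R = zeval v by apply: IHN ltmN x v m_gt0 int_x Dv.
case: (local_f q_pr) => [sep_f|[n [c [red_f ndvd]]]].
  exact: integral_descent_separable sep_f int_xm Dxm.
apply: (integral_descent_ramified q_pr red_f ndvd _ int_xm Dxm).
rewrite lt0n; apply: contraTneq (irr_f.1) => n0.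
have := congr1 (fun u : {poly _} => size u) red_f.
rewrite n0 expr0 size_poly1 size_map_poly_id0; last by rewrite (eqP mon_f) oner_neq0.
by rewrite size_rat_int_poly => ->.
Qed.

Lemma integral_zeval (x : L) :
  x \in <<1; theta>>%VS -> integral x -> exists v, x = zeval v.
Proof.
move=> /Fadjoin_polyP[r /polyOver1P[r0 ->] Dx] int_x.
have [g [a aN0 Dr0]] := rat_poly_scale r0.
have aLN0 : a%:~R != 0 :> L by rewrite -(rmorph_int (in_alg L)) fmorph_eq0 intr_eq0.
have Dxa : x * a%:~R = zeval g.
  rewrite Dx Dr0 map_polyZ hornerZ -map_poly_comp /zeval mulrC.
  rewrite fmorphV rmorph_int mulVKf //; congr _.[_].
  by apply: eq_map_poly => n /=; rewrite scaler_int.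
apply: (@integral_descent `|a|%N x (sgz a *: g)) => //; first by rewrite absz_gt0.
by rewrite zevalZ -Dxa -mulrA -rmorphM /= [a * _]mulrC -abszEsg pmulrn.
Qed.

(** Division with remainder by the monic f brings an element of Z[theta] to
    degree less than that of f. *)
Lemma monogenic_basis :
  Zbasis (ring_of_integers <<1; theta>>%AS)
         (fun i : 'I_(size f).-1 => theta ^+ i).
Proof.
have zeval_sum (c : 'I_(size f).-1 -> int) :
    \sum_(i < (size f).-1) theta ^+ i *~ c i =
      zeval (\sum_(i < (size f).-1) c i *: 'X^i).
  rewrite /zeval rmorph_sum horner_sum; apply: eq_bigr => i _ /=.
  by rewrite map_polyZ map_polyXn !hornerE mulrC mulrzr.
have sizef : size f = (size f).-1.+1 by rewrite prednK // size_poly_gt0 monic_neq0.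
split=> [x|c]; [split=> [[xE int_x]|[c ->]]|].
- have [v Dv] := integral_zeval xE int_x.
  pose r := Pdiv.Ring.rmodp v f.
  exists (fun i => r`_i); rewrite zeval_sum Dv.
  have {1}-> := Pdiv.RingMonic.rdivp_eq mon_f v.
  rewrite zevalD zevalM zeval_min mulr0 add0r -/r; congr zeval.
  rewrite -(poly_def (size f).-1 (fun i => r`_i)); apply/polyP=> i; rewrite coef_poly.
  case: ltnP => // le_i; rewrite nth_default //; apply: leq_trans le_i.
  by rewrite -ltnS -sizef Pdiv.Ring.ltn_rmodpN0 // monic_neq0.
- rewrite zeval_sum; split; last exact: zeval_integral.
  rewrite -zeval_sum; apply: rpred_sum => i _; rewrite -mulrzr rpredM ?rpred_int //.
  by rewrite rpredX ?memv_adjoin.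
rewrite zeval_sum => /zeval_eq0[h Dh] i.
pose r := \poly_(i < (size f).-1) (if insub i is Some j then c j else 0).
have Dr : \sum_(i < (size f).-1) c i *: 'X^i = r :> {poly int}.
  by rewrite /r poly_def; apply: eq_bigr => j _; rewrite valK.
have r0 : r = 0.
  apply: contraTeq (size_poly (size f).-1 (fun i => if insub i is Some j then c j else 0)).
  rewrite -/r -Dr Dh => nz; rewrite -ltnNge size_Mmonic //; last first.
    by apply: contraNneq nz => ->; rewrite mul0r.
  have : (0 < size h)%N by rewrite size_poly_gt0; apply: contraNneq nz => ->; rewrite mul0r.
  by move: sizef; move: (size f) (size h) => n m; lia.
by have := congr1 (fun u : {poly int} => u`_i) r0; rewrite coef_poly ltn_ord valK coef0.
Qed.

End MonogenicOrder.

(** Two cases of Dedekind's criterion: f is squarefree modulo q, or q is totally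
    ramified and f is an Eisenstein polynomial in X - c. *)
Lemma monogenic_criterion (f : {poly int}) :
  f \is monic -> irreducible_poly (map_poly (intr : int -> rat) f) ->
  (forall q : nat, prime q ->
     separable_poly (reduction q f) \/
     exists n (c : int), reduction q f = ('X - c%:~R%:P) ^+ n
                         /\ ~~ ((q ^ 2)%:Z %| f.[c])%Z) ->
  monogenic f.
Proof.
move=> mon_f irr_f loc; split=> // L theta root_f.
exact: monogenic_basis mon_f irr_f root_f loc.
Qed.

(** * The trinomial of prime discriminant *)

Lemma exp_Fp (p : nat) (x : 'F_p) : prime p -> x ^+ p = x.
Proof. by move=> p_pr; rewrite -[X in x ^+ X](card_Fp p_pr) expf_card. Qed.

Lemma expB_poly_Fp (p : nat) (u v : {poly 'F_p}) :
  prime p -> (u - v) ^+ p = u ^+ p - v ^+ p.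
Proof.
move=> p_pr; have pcharP : p \in [pchar {poly 'F_p}].
  by rewrite pchar_poly pchar_Fp.
by rewrite -!(pFrobenius_autE pcharP) pFrobenius_autB_comm //; apply: mulrC.
Qed.

Lemma prime_sqr_not_dvd (p : nat) : prime p -> ~~ ((p ^ 2)%:Z %| p%:Z)%Z.
Proof.
move=> p_pr; rewrite dvdzE /= -[p in (_ %| p)%N]expn1.
by rewrite dvdn_Pexp2l // prime_gt1.
Qed.

Lemma reduction_trinomial (q p a : nat) :
  reduction q (trinomial p a) = 'X^(2 * p) + a%:R *: 'X^p - 1.
Proof. exact: map_trinomial. Qed.

(** With Y = X^p one has X f' = p Y (2Y + a), modulo f also Y (Y + a) = 1, and
    (2Y + a)^2 = 4f + a^2 + 4. Multiplying X f' by (Y + a)(2Y + a) therefore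
    gives p (a^2 + 4) modulo f. *)
Lemma separable_trinomial (F : fieldType) (p a : nat) :
  (a ^ 2 + 4)%:R != 0 :> F -> p%:R != 0 :> F ->
  separable_poly ('X^(2 * p) + a%:R *: 'X^p - 1 : {poly F}).
Proof.
move=> D0 p0; have p_gt0 : (0 < p)%N.
  by rewrite lt0n; apply: contraNneq p0 => ->.
set f := _ - 1; rewrite unlock.
set Y := 'X^p : {poly F}; set A := (a%:R)%:P : {poly F}.
set P := (p%:R)%:P : {poly F}; set D := ((a ^ 2 + 4)%:R)%:P : {poly F}.
have Df : f = Y ^+ 2 + A * Y - 1.
  by rewrite /f /Y /A mul_polyC -exprM mulnC.
have DD : D = A ^+ 2 + 4%:R by rewrite /D natrD natrX polyCD polyC_exp (polyC_natr _ 4).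
have XfE : 'X * f^`() = P * Y * (2%:R * Y + A).
  rewrite /f derivB derivD derivZ !derivXn derivC subr0 mulrDr.
  rewrite -scalerAr !mulrnAr -!exprS !prednK ?muln_gt0 //.
  rewrite -(mulr_natl 'X^(2 * p)) -(mulr_natl 'X^p) natrM -mul_polyC -/A.
  by rewrite [(2 * p)%N]mulnC exprM -/Y /P (polyC_natr _ p); ring.
apply/Bezout_coprimepP.
exists (- (P * (4%:R * f + D + 4%:R)), 'X * (Y + A) * (2%:R * Y + A)) => /=.
have -> : - (P * (4%:R * f + D + 4%:R)) * f + 'X * (Y + A) * (2%:R * Y + A) * f^`() = P * D.
  have -> : 'X * (Y + A) * (2%:R * Y + A) * f^`() =
            ('X * f^`()) * (2%:R * Y + A) * (Y + A) by ring.
  by rewrite XfE DD Df; ring.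
by rewrite /P /D -polyCM -alg_polyC eqp_scale // mulf_neq0.
Qed.

Section PrimeDiscriminant.

Variables (p a : nat).
Hypotheses (p_pr : prime p) (Dp : p = (a ^ 2 + 4)%N).

Lemma prime_disc_odd : odd p.
Proof. by case/even_prime: p_pr => // p2; move: Dp; lia. Qed.

Let a_odd : odd a.
Proof. by have := prime_disc_odd; rewrite {1}Dp oddD oddX /= addbF. Qed.

(* The integer c with 2c + a = p represents -a/2 modulo p. *)
Let c : int := (p - a)./2%:Z.

Let Dc : 2%:Z * c + a%:Z = p%:Z.
Proof.
have := prime_disc_odd; have le_ap : (a <= p)%N by rewrite Dp; nia.
move=> p_odd; have : ~~ odd (p - a) by rewrite oddB // p_odd a_odd.
rewrite /c; move: (p - a)%N (subnK le_ap) => b Db /negPf b_even.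
by have := odd_double_half b; rewrite b_even; lia.
Qed.

Let Dc_Fp : c%:~R *+ 2 = - a%:R :> 'F_p.
Proof.
have E : (2%:Z * c + a%:Z)%:~R = c%:~R *+ 2 + a%:R :> 'F_p.
  by rewrite rmorphD rmorphM /= mulr_natl.
by apply/eqP; rewrite -addr_eq0 -E Dc intr_Fp_eq0.
Qed.

(** As a^2 = -4 modulo p, c^2 = -1 and X^2 + aX - 1 = (X - c)^2; the p-th power
    of this identity is the claim, by Frobenius and c^p = c. *)
Lemma reduction_prime_disc : reduction p (trinomial p a) = ('X - c%:~R%:P) ^+ (2 * p).
Proof.
have four_neq0 : 4%:R != 0 :> 'F_p.
  rewrite -[4%:R]/(4%:Z%:~R) intr_Fp_eq0 //; apply/negP => /dvdn_leq /=.
  by rewrite {1}Dp; have : (0 < a)%N by [case: (a) a_odd]; nia.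
have c2 : c%:~R ^+ 2 = -1 :> 'F_p.
  apply: (mulfI four_neq0); have -> : 4%:R * c%:~R ^+ 2 = (c%:~R *+ 2) ^+ 2 :> 'F_p by ring.
  rewrite Dc_Fp sqrrN mulrN1; apply/eqP; rewrite -addr_eq0 -natrX -natrD -Dp.
  by rewrite -[p%:R]/(p%:Z%:~R) intr_Fp_eq0.
rewrite reduction_trinomial mulnC exprM [RHS]exprM expB_poly_Fp // -polyC_exp exp_Fp //.
rewrite sqrrB -polyC_exp c2 -mulrnAr -polyCMn Dc_Fp polyCN mulrN opprK.
by rewrite [_ * _%:P]mulrC mul_polyC polyCN.
Qed.

(** Four times the value at c is (2 c^p + a)^2 - p, and p divides 2 c^p + a by
    Fermat's little theorem. *)
Lemma trinomial_ndvd : ~~ ((p ^ 2)%:Z %| (trinomial p a).[c])%Z.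
Proof.
set e := 2%:Z * c ^+ p + a%:Z.
have dvd_e : (p%:Z %| e)%Z.
  rewrite -intr_Fp_eq0 // rmorphD rmorphM rmorphXn /= exp_Fp // mulr_natl Dc_Fp.
  by rewrite addNr.
have fc : 4%:Z * (trinomial p a).[c] = e ^+ 2 - p%:Z.
  have -> : p%:Z = a%:Z ^+ 2 + 4%:Z by move: Dp; lia.
  by rewrite /trinomial !hornerE mulnC exprM /e; move: (c ^+ p) => t; ring.
apply/negP => dvd_fc; have := prime_sqr_not_dvd p_pr; case/negP.
have -> : p%:Z = e ^+ 2 - 4%:Z * (trinomial p a).[c] by rewrite fc; ring.
rewrite rpredB //; last by rewrite dvdz_mull.
by rewrite -[(p ^ 2)%N%:Z]/(p%:Z * p%:Z) expr2 dvdz_mul.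
Qed.

Lemma trinomial_irreducible :
  irreducible_poly (map_poly (intr : int -> rat) (trinomial p a)).
Proof.
apply: totally_ramified_irreducible reduction_prime_disc trinomial_ndvd => //.
  exact: trinomial_monic (prime_gt0 p_pr).
by rewrite size_trinomial ?prime_gt0 //; have := prime_gt0 p_pr; lia.
Qed.

Lemma trinomial_monogenic : monogenic (trinomial p a).
Proof.
apply: monogenic_criterion; first exact: trinomial_monic (prime_gt0 p_pr).
  exact: trinomial_irreducible.
move=> q q_pr; have [->|neq_qp] := eqVneq q p.
  by right; exists (2 * p)%N, c; split; [exact: reduction_prime_disc | exact: trinomial_ndvd].
have pN0 : p%:R != 0 :> 'F_q.
  by rewrite -[p%:R]/(p%:Z%:~R) intr_Fp_eq0 // dvdzE /= dvdn_prime2.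
by left; rewrite reduction_trinomial separable_trinomial // -Dp.
Qed.

End PrimeDiscriminant.

(** Modulo p this is (X - 1)^(p-1), and its value at 1 is p. *)
Lemma cyclotomic_prime_irreducible (p : nat) : prime p ->
  irreducible_poly (\sum_(i < p) 'X^i : {poly rat}).
Proof.
move=> p_pr; have p_gt0 := prime_gt0 p_pr.
pose phi : {poly int} := \sum_(i < p) 'X^i.
have phiX (R : nzRingType) : map_poly (intr : int -> R) phi = \sum_(i < p) 'X^i.
  by rewrite rmorph_sum; apply: eq_bigr => i _ /=; rewrite map_polyXn.
have phi_poly : phi = \poly_(i < p) 1.
  by rewrite poly_def; apply: eq_bigr => i _; rewrite scale1r.
have size_phi : size phi = p.
  by rewrite phi_poly -(prednK p_gt0) size_poly_eq ?oner_neq0.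
rewrite -phiX; apply: (@totally_ramified_irreducible p p.-1 phi 1) => //.
- by rewrite monicE lead_coefE size_phi phi_poly coef_poly prednK // leqnn.
- by rewrite size_phi prime_gt1.
- have X1 : 'X - 1 != 0 :> {poly 'F_p} by rewrite polyXsubC_eq0.
  rewrite phiX; apply: (mulfI X1); rewrite -subrX1 rmorph1 -exprS prednK //.
  by rewrite expB_poly_Fp // expr1n.
rewrite horner_sum; under eq_bigr do rewrite hornerXn expr1n.
by rewrite sumr_const card_ord natz prime_sqr_not_dvd.
Qed.

(** * The Galois group *)

Lemma exists_splitting_field (f : {poly int}) : f \is monic ->
  exists L : splittingFieldType rat,
    splittingFieldFor 1 (map_poly (intr : int -> L) f) {:L}.
Proof.
move=> mon_f; have [r Dr] := closed_field_poly_normal (map_poly (intr : int -> algC) f).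
have mapf (R : nzRingType) : map_poly (intr : int -> R) f \is monic by apply: monic_map.
rewrite (monicP (mapf algC)) scale1r in Dr.
have [Qs [QsC [s Ds gen_s]]] := num_field_exists r.
have splitf : splittingFieldFor 1 (map_poly (intr : int -> Qs) f) {:Qs}.
  exists s => //; rewrite (_ : map_poly _ f = \prod_(x <- s) ('X - x%:P)) ?eqpxx //.
  apply: (map_poly_inj QsC); rewrite -map_poly_comp.
  rewrite (eq_map_poly (g := intr)) => [|n /=]; last exact: rmorph_int.
  rewrite Dr -Ds rmorph_prod big_map; apply: eq_bigr => x _ /=.
  by rewrite rmorphB /= map_polyX map_polyC.
have Qs_ax : FieldExt_isSplittingField _ Qs.
  constructor; exists (map_poly intr f) => //.
  by apply/polyOverP=> i; rewrite coef_map /= rpred_int.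
by exists (HB.pack_for (splittingFieldType rat) Qs Qs_ax).
Qed.

Lemma dim_adjoin_irreducible (L : fieldExtType rat) (x : L) (P : {poly rat}) :
  irreducible_poly P -> root (map_poly (in_alg L) P) x ->
  \dim <<1; x>> = (size P).-1.
Proof.
move=> irrP rootP; have dvdP : minPoly 1 x %| map_poly (in_alg L) P.
  by apply: minPoly_dvdp rootP; apply/polyOver1P; exists P.
have /polyOver1P[m Dm] : minPoly 1 x \is a polyOver 1%VS := minPolyOver 1 x.
have size_m : size m = (adjoin_degree 1 x).+1 by rewrite -size_minPoly Dm size_map_poly.
have /eqp_size <- : m %= P.
  apply: irrP; first by rewrite size_m eqSS -lt0n.
  by rewrite -(dvdp_map (in_alg L)) -Dm.
by rewrite size_m dim_Fadjoin dimv1 muln1.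
Qed.

(** The splitting field is studied as the tower Q < F = Q(zeta_p) < F(theta). An
    automorphism is determined by the images of z and theta, which are a power
    of z and one of z^i theta and - z^i / theta. *)
Section GaloisGroup.

Variables (p a : nat) (L : splittingFieldType rat) (theta z : L).
Hypotheses (p_pr : prime p) (Dp : p = (a ^ 2 + 4)%N).
Hypothesis splitL : splittingFieldFor 1 (map_poly (intr : int -> L) (trinomial p a)) {:L}.
Hypothesis th_root : root (map_poly intr (trinomial p a)) theta.
Hypothesis z_prim : p.-primitive_root z.

Let odd_p : odd p := prime_disc_odd p_pr Dp.
Let p_gt0 : (0 < p)%N := prime_gt0 p_pr.

Let th1 : theta ^+ p * (theta ^+ p + a%:R) = 1.
Proof. by apply/eqP; rewrite -root_trinomial. Qed.

Let thN0 : theta != 0.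
Proof.
apply: contra_eq_neq th1 => ->; rewrite expr0n gtn_eqF // mul0r eq_sym.
exact: oner_neq0.
Qed.

(* a is odd, so p = a^2 + 4 = 5 mod 8 and (p - 1)/2 is even: p* = p. *)
Let even_half : odd p./2 = false.
Proof.
have a_odd : odd a by move: odd_p; rewrite {1}Dp oddD oddX /= addbF.
have Da : a = (a./2.*2).+1 by rewrite -[LHS]odd_double_half a_odd.
have -> : p./2 = (2 * (a./2 ^ 2 + a./2 + 1))%N.
  have : p = (p./2.*2).+1 by rewrite -[LHS]odd_double_half odd_p.
  by rewrite {1}Dp {1}Da; move: (p./2) (a./2) => k b; lia.
by rewrite oddM.
Qed.

(* delta and eps are two square roots of p, one in Q(theta^p), the other in
   Q(z). *)
Let delta : L := theta ^+ p *+ 2 + a%:R.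
Let eps : L := sqrt_pstar p z.

Let delta2 : delta ^+ 2 = p%:R.
Proof. by rewrite Dp natrD natrX (root_quadratic_disc th1). Qed.

Let delta_eps : delta = eps \/ delta = - eps.
Proof.
have e2 : eps ^+ 2 = p%:R by rewrite sqrt_pstarK // -signr_odd even_half mul1r.
by apply/pred2P; rewrite -eqf_sqr delta2 e2.
Qed.

(** The p-th power of a root is theta^p or the other root -1/theta^p of the
    quadratic; p being odd, it is the p-th power of theta or of -1/theta. *)
Lemma root_trinomial_cases (x : L) :
  root (map_poly intr (trinomial p a)) x ->
  exists i : nat, x = z ^+ i * theta \/ x = - (z ^+ i / theta).
Proof.
rewrite root_trinomial => /eqP x1.
have : (x ^+ p - theta ^+ p) * (x ^+ p + theta ^+ p + a%:R) = 0.
  have -> : (x ^+ p - theta ^+ p) * (x ^+ p + theta ^+ p + a%:R) =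
    x ^+ p * (x ^+ p + a%:R) - theta ^+ p * (theta ^+ p + a%:R) by ring.
  by rewrite x1 th1 subrr.
move/eqP; rewrite mulf_eq0 subr_eq0 -addrA addr_eq0 => /orP[]/eqP xp.
  have [|i Di] := prim_rootP z_prim (_ : (x / theta) ^+ p = 1).
    by rewrite expr_div_n xp divff // expf_neq0.
  by exists i; left; rewrite -Di divfK.
have [|i Di] := prim_rootP z_prim (_ : (- (x * theta)) ^+ p = 1).
  by rewrite exprNn -signr_odd odd_p expr1 mulN1r exprMn xp mulNr opprK mulrC.
by exists i; right; rewrite -Di mulNr opprK mulfK.
Qed.

Let F : {subfield L} := <<1; z>>%AS.

Let eps_in : eps \in F.
Proof.
have zF : z \in F by apply: memv_adjoin.
by apply: rpred_prod => i _; rewrite rpredB ?rpredV ?rpredX.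
Qed.

Let thetap_in : theta ^+ p \in F.
Proof.
have -> : theta ^+ p = (delta - a%:R) / 2%:R.
  by rewrite addrK -mulr_natr mulfK // natr_fieldExt_neq0.
rewrite rpred_div ?rpredB ?rpred_nat //.
by case: delta_eps => ->; rewrite ?rpredN.
Qed.

Lemma splitting_field_gen : <<F; theta>>%VS = fullv.
Proof.
have [rs Drs gen] := splitL; apply/eqP; rewrite eqEsubv subvf -gen /=.
apply/Fadjoin_seqP; split; first by rewrite (subv_trans (sub1v F)) ?subv_adjoin.
move=> x rs_x; have zE : z \in <<F; theta>>%VS.
  by apply: (subvP (subv_adjoin F theta)); apply: memv_adjoin.
have thE : theta \in <<F; theta>>%VS by apply: memv_adjoin.
have [|i [->|->]] := @root_trinomial_cases x.
- by rewrite (eqp_root Drs) root_prod_XsubC.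
- by rewrite rpredM ?rpredX.
by rewrite rpredN rpred_div ?rpredX.
Qed.

Let dimF : \dim F = p.-1.
Proof.
rewrite (dim_adjoin_irreducible (cyclotomic_prime_irreducible p_pr)).
  have -> : \sum_(i < p) 'X^i = \poly_(i < p) 1 :> {poly rat}.
    by rewrite poly_def; apply: eq_bigr => i _; rewrite scale1r.
  by rewrite -(prednK p_gt0) size_poly_eq ?oner_neq0.
have z1 : z - 1 != 0.
  rewrite subr_eq0 -[z]expr1 -(prim_order_dvd z_prim) dvdn1 neq_ltn.
  by rewrite prime_gt1 ?orbT.
rewrite rootE rmorph_sum horner_sum; apply/eqP/(mulfI z1); rewrite mulr0.
under eq_bigr do rewrite /= map_polyXn hornerXn.
by rewrite -subrX1 (prim_expr_order z_prim) subrr.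
Qed.

(** The degree of theta over F is at most p, because theta^p is in F. It is a
    multiple of p, because 2p, the degree of theta over Q, divides the product
    of that degree by p - 1. *)
Lemma dim_splitting_field : adjoin_degree F theta = p /\ \dim {:L} = (p * p.-1)%N.
Proof.
have dimL : \dim {:L} = (adjoin_degree F theta * p.-1)%N.
  by rewrite -splitting_field_gen dim_Fadjoin dimF.
suff Dd : adjoin_degree F theta = p by rewrite dimL Dd.
have le_dp : (adjoin_degree F theta <= p)%N.
  have dvd_m : minPoly F theta %| 'X^p - (theta ^+ p)%:P.
    apply: minPoly_dvdp; first by rewrite rpredB ?rpredX ?polyOverX ?polyOverC.
    by rewrite rootE !hornerE subrr.
  have := dvdp_leq (monic_neq0 (monicXnsubC _ p_gt0)) dvd_m.
  by rewrite size_minPoly size_XnsubC.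
have dvd_p : (p %| adjoin_degree F theta)%N.
  have cop : coprime p p.-1 by rewrite -{1}(prednK p_gt0) coprimeSn.
  rewrite -(Gauss_dvdl _ cop) -dimL; apply: (@dvdn_trans (2 * p)); first exact: dvdn_mull.
  have <- : \dim <<1; theta>> = (2 * p)%N.
    rewrite (dim_adjoin_irreducible (trinomial_irreducible p_pr Dp)).
      by rewrite size_rat_int_poly size_trinomial.
    rewrite -map_poly_comp (eq_map_poly (g := intr)) // => n /=.
    exact: scaler_int.
  exact: (field_dimS (subvf _)).
by apply/eqP; rewrite eqn_leq le_dp dvdn_leq.
Qed.

Let G := 'Gal({:L} / 1)%G.
Let N := 'Gal({:L} / F)%G.

Let gal_root (s : gal_of {:L}) :
  exists i : nat, s theta = z ^+ i * theta \/ s theta = - (z ^+ i / theta).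
Proof.
apply: root_trinomial_cases; rewrite root_trinomial.
have := congr1 s th1; rewrite rmorph1 rmorphM rmorphD rmorphXn /= rmorph_nat.
by move->.
Qed.

Let gal_zeta (s : gal_of {:L}) : exists i : nat, s z = z ^+ i.
Proof.
have [|i Di] := prim_rootP z_prim (_ : s z ^+ p = 1); last by exists i.
by rewrite -rmorphXn (prim_expr_order z_prim) rmorph1.
Qed.

Let memN (s : gal_of {:L}) : (s \in N) = (s z == z).
Proof.
apply/idP/eqP=> [sN|sz]; first by apply: (fixed_gal (subvf F) sN); apply: memv_adjoin.
rewrite gal_kHom ?subvf //; apply/andP; split.
  by case/andP: (k1AHom {:L} s).
by rewrite sub_adjoin1v; apply/fixedSpaceP.
Qed.

Let gal_eq1 (s : gal_of {:L}) : s z = z -> s theta = theta -> s = 1%g.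
Proof.
move=> sz sth; apply/eqP/gal_eqP=> x _; rewrite gal_id.
suff : (<<F; theta>> <= fixedSpace s)%VS.
  by rewrite splitting_field_gen => /subvP/(_ x (memvf _))/fixedSpaceP.
apply/FadjoinP; split; last exact/fixedSpaceP.
by rewrite sub_adjoin1v; apply/fixedSpaceP.
Qed.

Lemma card_gal : #|G| = (p * p.-1)%N.
Proof. by rewrite -(galois_dim (galois_over_rat L)) dimv1 divn1; case: dim_splitting_field. Qed.

Lemma card_gal_kummer : #|N| = p.
Proof.
have galF : galois F {:L} by apply: galoisS (galois_over_rat L); rewrite sub1v subvf.
rewrite -(galois_dim galF); have [<- _] := dim_splitting_field.
by rewrite adjoin_degreeE splitting_field_gen.
Qed.

(** These are the automorphisms that fix z, and every conjugate of z is a power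
    of z. *)
Lemma gal_kummer_normal : (N <| G)%g.
Proof.
rewrite /normal galS ?sub1v //=; apply/subsetP=> t _; rewrite inE.
apply/subsetP=> _ /imsetP[s sN ->]; rewrite memN.
have /eqP sz : s z == z by rewrite -memN.
have [i ti] := gal_zeta t^-1%g.
rewrite conjgE !galM ?memvf // ti rmorphXn /= sz -ti -galM ?memvf //.
by rewrite mulVg gal_id.
Qed.

Let gal_kummer (s : gal_of {:L}) :
  s \in N -> exists i : nat, s theta = z ^+ i * theta.
Proof.
move=> sN; have sp : s theta ^+ p = theta ^+ p.
  by rewrite -rmorphXn; apply: (fixed_gal (subvf F) sN).
have [|i Di] := prim_rootP z_prim (_ : (s theta / theta) ^+ p = 1).
  by rewrite expr_div_n sp divff // expf_neq0.
by exists i; rewrite -Di divfK.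
Qed.

(* For x = z^i: if p divides i j but not j, it divides i. *)
Let zeta_pow_inj (x : L) (j : nat) :
  x ^+ p = 1 -> z ^+ j != 1 -> x ^+ j = 1 -> x = 1.
Proof.
move=> xp zj xj; have [i Di] := prim_rootP z_prim xp.
move/eqP: xj; rewrite Di -exprM -(prim_order_dvd z_prim) Euclid_dvdM //.
rewrite [(p %| j)%N](prim_order_dvd z_prim) (negPf zj) orbF (prim_order_dvd z_prim).
by move/eqP.
Qed.

(** Let s <> 1 be an automorphism over F, s theta = z^j theta, and let t
    commute with s. If t theta = z^m theta, then commutation forces t z = z. If
    t theta = - z^m / theta, it forces t z = 1/z; then t fixes eps, as (p-1)/2 is
    even, hence it fixes delta = +-eps. But t exchanges the two roots of the
    quadratic and so it negates delta. *)
Lemma cent_gal_kummer : ('C_G(N) \subset N)%g.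
Proof.
have zN0 : z != 0 by rewrite (prim_root_eq0 z_prim) -lt0n.
have [s sN s1] : exists2 s, s \in N & s != 1%g.
  by apply/trivgPn; rewrite -cardG_gt1 card_gal_kummer prime_gt1.
have /eqP sz : s z == z by rewrite -memN.
have [j sth] := gal_kummer sN.
have zj : z ^+ j != 1.
  by apply: contraNneq s1 => zj; apply/eqP/gal_eq1; rewrite ?sth ?zj ?mul1r.
apply/subsetP=> t /setIP[_ /centP/(_ s sN) cts].
have {}cts : s (t theta) = t (s theta) by rewrite -!galM ?memvf // cts.
have tzp : t z ^+ p = 1 by rewrite -rmorphXn (prim_expr_order z_prim) rmorph1.
rewrite memN; have [m [tth|tth]] := gal_root t.
  rewrite sth tth !rmorphM !rmorphXn /= sz sth tth in cts.
  suff tz1 : t z / z = 1 by rewrite -[t z](divfK zN0) tz1 mul1r.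
  apply: (zeta_pow_inj _ zj); first by rewrite expr_div_n tzp (prim_expr_order z_prim) divr1.
  rewrite expr_div_n; apply: (mulIf (expf_neq0 j zN0)); rewrite divfK ?expf_neq0 // mul1r.
  have zmth : z ^+ m * theta != 0 by rewrite mulf_neq0 ?expf_neq0.
  by apply: (mulIf zmth); rewrite -cts; ring.
have tz : t z = z^-1.
  suff tz1 : t z * z = 1 by rewrite -[LHS](mulfK zN0) tz1 mul1r.
  apply: (zeta_pow_inj _ zj); first by rewrite exprMn tzp (prim_expr_order z_prim) mulr1.
  rewrite sth tth rmorphN !rmorphM !rmorphXn fmorphV /= sz sth tth in cts.
  have zmth : - (z ^+ m / theta) != 0 by rewrite oppr_eq0 mulf_neq0 ?invr_neq0 ?expf_neq0.
  have zjN0 : z ^+ j != 0 by rewrite expf_neq0.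
  rewrite exprMn; apply: (mulIf zmth); rewrite mulrAC -cts.
  by field; rewrite thN0 zjN0.
have t_delta : t delta = delta.
  have t_eps : t eps = eps.
    by rewrite /eps rmorph_sqrt_pstar /= tz sqrt_pstar_inv -signr_odd even_half mul1r.
  by case: delta_eps => ->; rewrite ?rmorphN /= t_eps.
have tthp : t (theta ^+ p) = - (theta ^+ p + a%:R).
  rewrite rmorphXn /= tth exprNn -signr_odd odd_p expr1 mulN1r expr_div_n.
  rewrite -exprM mulnC exprM (prim_expr_order z_prim) expr1n mul1r; congr (- _).
  by apply: (mulfI (expf_neq0 p thN0)); rewrite th1 divff // expf_neq0.
have t_deltaN : t delta = - delta.
  by rewrite rmorphD rmorphMn rmorph_nat /= tthp /delta; ring.
have : delta *+ 2 = 0 by rewrite mulr2n -{1}t_delta t_deltaN addNr.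
have two_neq0 := natr_fieldExt_neq0 L (isT : (0 < 2)%N).
move/eqP; rewrite -mulr_natr mulf_eq0 (negPf two_neq0) orbF => /eqP d0.
by have /esym/eqP := delta2; rewrite d0 expr0n (negPf (natr_fieldExt_neq0 L p_gt0)).
Qed.

End GaloisGroup.


(** * The equivalence *)

Lemma Gal_trinomial (p a : nat) :
  prime p -> p = (a ^ 2 + 4)%N -> Gal_isog_Cp_Cp1 (trinomial p a) p.
Proof.
move=> p_pr Dp; have p_gt2 : (2 < p)%N by rewrite Dp; lia.
have [L splitL] := exists_splitting_field (trinomial_monic a (prime_gt0 p_pr)).
have [theta [z [th_root z_prim]]] := trinomial_splits p_pr splitL.
have cG := card_gal p_pr Dp splitL th_root z_prim.
have nN := gal_kummer_normal z_prim.
have cN := card_gal_kummer p_pr Dp splitL th_root z_prim.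
have CN := cent_gal_kummer p_pr Dp splitL th_root z_prim.
have [to faithful_to isoG] := holomorph_Cp p_pr p_gt2 cG nN cN CN.
by exists to => //; exists L.
Qed.

Lemma trinomial_spec (p a : nat) : prime p -> (2 < p)%N -> (0 < a)%N ->
  monogenic (trinomial p a) /\ Gal_isog_Cp_Cp1 (trinomial p a) p <->
  p = (a ^ 2 + 4)%N.
Proof.
move=> p_pr p_gt2 a_gt0; split=> [[mono [to _ [L splitL isoG]]]|Dp]; last first.
  by split; [apply: trinomial_monogenic | apply: Gal_trinomial].
have odd_p : odd p by case: (even_prime p_pr) p_gt2 => // ->.
have [N [g [oddN defG]]] := sdprod_by_odd_cyclic (prime_gt1 p_pr) odd_p isoG.
have [s Ds] := trinomial_disc p_pr odd_p a_gt0 splitL oddN defG.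
have [theta [z [th_root _]]] := trinomial_splits p_pr splitL.
have s1 := monogenic_trinomial_disc p_pr odd_p mono th_root Ds.
by rewrite Ds s1 muln1.
Qed.

Lemma finite_nat_bounded (A : set nat) :
  finite_set A -> exists N, forall n, A n -> (n <= N)%N.
Proof.
case/finite_seqP=> s ->; exists (\max_(x <- s) x) => n /= sn.
exact: leq_bigmax_seq.
Qed.

Theorem corollary1p3 :
  (forall N : nat, (2 < N)%N ->
     exists p : nat,
       [/\ prime p, (N < p)%N
         & exists! a : nat,
             let f : {poly int} := ('X^(2 * p) + a%:Z *: 'X^p - 1)%R in
             [/\ (0 < a)%N, monogenic f & Gal_isog_Cp_Cp1 f p]])
  <->
  infinite_set
    [set p : nat | prime p /\ exists z : nat, (0 < z)%N /\ p = (z ^ 2 + 4)%N]%classic.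
Proof.
split=> [exA /finite_nat_bounded[N boundN] | infB N N_gt2].
  have [|p [p_pr ltNp [a [[a_gt0 mono galf] _]]]] := exA N.+3; first by [].
  have Dp : p = (a ^ 2 + 4)%N by apply/(trinomial_spec p_pr _ a_gt0) => //; lia.
  by have := boundN p (conj p_pr (ex_intro _ a (conj a_gt0 Dp))); lia.
have [p [[p_pr [z [z_gt0 Dp]]] ltNp]] :
    exists p, (prime p /\ exists z, (0 < z)%N /\ p = (z ^ 2 + 4)%N) /\ (N < p)%N.
  apply: boolp.contrapT => noP; apply: infB.
  apply: sub_finite_set (finite_II N.+1) => p Bp /=.
  by rewrite ltnNge; apply/negP=> ltNp; apply: noP; exists p.
have p_gt2 : (2 < p)%N by apply: ltn_trans ltNp.
exists p; split=> //; exists z; split=> [|a [a_gt0 mono galf]].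
  by have [mono galf] := (trinomial_spec p_pr p_gt2 z_gt0).2 Dp.
have := (trinomial_spec p_pr p_gt2 a_gt0).1 (conj mono galf).
by rewrite {1}Dp => Dz; apply/eqP; rewrite -eqn_sqr; apply/eqP; lia.
Qed.
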